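(* Let $R$ be a commutative ring. The generating hypothesis is true in the derived category $\mathcal{D}(R)$ of $R$-modules if and only if $R$ is von Neumann regular.
   Context: In $\mathcal{D}(R)$ (the unbounded derived category of $R$-modules), let $S$ be the chain complex with $R$ in degree zero and $0$ elsewhere, and write $\pi_iX=\operatorname{Hom}_{\mathcal{D}(R)}(\Sigma^iS,X)$ (the $i$-th homology of $X$), $\pi_*X=\bigoplus_i\pi_iX$. The thick subcategory $\mathbf{thick}\langle S\rangle$ is the smallest class of objects containing $S$ and closed under (de)suspension, retracts, and cofiber sequences (if two of three objects in an exact triangle belong to it, so does the third). The generating hypothesis in $\mathcal{D}(R)$ is the statement: if $f:X\to Y$ is a morphism in $\mathcal{D}(R)$ between objects of $\mathbf{thick}\langle S\rangle$ and $\pi_*f=0$, then $f=0$. A ring $R$ is von Neumann regular if for every $x\in R$ there is $y\in R$ with $xyx=x$. *)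

(* Defs.v *)
From HB Require Import structures.
From mathcomp Require Import all_boot all_order all_algebra.

Set Implicit Arguments.
Unset Strict Implicit.
Unset Printing Implicit Defensive.

Import GRing.Theory.
Local Open Scope ring_scope.

(* Unbounded chain complexes of R-modules, homologically graded by int.  The
   differential is a family [diff i j : X i -> X j] that vanishes off the line
   i = j + 1; so X can be shifted, and cones formed, with no transport along
   equations between degrees. *)
Record complex (R : comPzRingType) := Complex {
  cobj :> int -> lmodType R;
  diff : forall i j, {linear cobj i -> cobj j};
  diff_shape : forall i j x, i != j + 1 -> diff i j x = 0;
  diff_diff : forall i j k x, diff j k (diff i j x) = 0 }.

Arguments diff {R} c i j.

Record chmap (R : comPzRingType) (X Y : complex R) := ChMap {
  chfun :> forall i, {linear X i -> Y i};
  chfun_diff : forall i j x, chfun j (diff X i j x) = diff Y i j (chfun i x) }.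

Section ChainMaps.
Variable R : comPzRingType.
Implicit Types X Y Z : complex R.

Definition chid X : chmap X X :=
  @ChMap R X X (fun i => idfun) (fun i j x => erefl).

Lemma chcomp_diff X Y Z (g : chmap Y Z) (f : chmap X Y) i j x :
  g j (f j (diff X i j x)) = diff Z i j (g i (f i x)).
Proof. by rewrite !chfun_diff. Qed.

Definition chcomp X Y Z (g : chmap Y Z) (f : chmap X Y) : chmap X Z :=
  @ChMap R X Z (fun i => g i \o f i) (chcomp_diff g f).

Lemma chzero_diff X Y i j (x : X i) : 0 = diff Y i j 0.
Proof. by rewrite linear0. Qed.

Definition chzero X Y : chmap X Y := @ChMap R X Y (fun i => \0) (@chzero_diff X Y).

(* Only the components h n (n + 1) of the homotopy h matter. *)
Definition homotopic X Y (f g : chmap X Y) : Prop :=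
  exists h : forall i j, {linear X i -> Y j}, forall n x,
    f n x - g n x =
      diff Y (n + 1) n (h n (n + 1) x) + h (n - 1) n (diff X n (n - 1) x).

Definition is_cycle X n (x : X n) : Prop := diff X n (n - 1) x = 0.

Definition is_boundary X n (x : X n) : Prop :=
  exists y : X (n + 1), x = diff X (n + 1) n y.

(* The two clauses are injectivity and surjectivity of s on n-th homology. *)
Definition quasi_iso X Y (s : chmap X Y) : Prop :=
  forall n,
    (forall x : X n, is_cycle x -> is_boundary (s n x) -> is_boundary x) /\
    (forall y : Y n, is_cycle y ->
       exists2 x : X n, is_cycle x & is_boundary (y - s n x)).

End ChainMaps.

Section Shift.
Variable R : comPzRingType.
Implicit Types X Y : complex R.

(* Sigma^k X : (Sigma^k X)_i = X_(i - k), with differential (-1)^k d. *)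
Definition shift_diff (k : int) X i j : X (i - k) -> X (j - k) :=
  (-1) ^+ `|k|%N \*: diff X (i - k) (j - k).

HB.instance Definition _ k X i j :=
  GRing.Linear.copy (@shift_diff k X i j) ((-1) ^+ `|k|%N \*: diff X (i - k) (j - k)).

Lemma shift_diff_shape k X i j (x : X (i - k)) :
  i != j + 1 -> shift_diff j x = 0.
Proof.
move=> ij; rewrite /shift_diff /= diff_shape ?scaler0 //.
by rewrite addrAC (inj_eq (addIr _)).
Qed.

Lemma shift_diff_diff k X i j l (x : X (i - k)) :
  shift_diff l (shift_diff j x) = 0.
Proof. by rewrite /shift_diff /= linearZ /= diff_diff !scaler0. Qed.

Definition shift (k : int) X : complex R :=
  @Complex R (fun i => X (i - k)) (fun i j => @shift_diff k X i j)
    (@shift_diff_shape k X) (@shift_diff_diff k X).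

Lemma shift_map_diff k X Y (f : chmap X Y) i j (x : shift k X i) :
  f (j - k) (diff (shift k X) i j x) = diff (shift k Y) i j (f (i - k) x).
Proof. by rewrite /= /shift_diff /= linearZ /= chfun_diff. Qed.

Definition shift_map k X Y (f : chmap X Y) : chmap (shift k X) (shift k Y) :=
  @ChMap R (shift k X) (shift k Y) (fun i => f (i - k)) (@shift_map_diff k X Y f).

Lemma sign_scaleK (n : nat) (V : lmodType R) (x : V) :
  (-1) ^+ n *: ((-1) ^+ n *: x) = x.
Proof. by rewrite scalerA -exprMn mulrNN mulr1 expr1n scale1r. Qed.

Lemma shift_cycle k X n (x : shift k X n) :
  @is_cycle R (shift k X) n x <-> @is_cycle R X (n - k) x.
Proof.
rewrite /is_cycle /= /shift_diff /= [n - k - 1]addrAC.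
by split=> [/(congr1 ( *:%R ((-1) ^+ `|k|%N)))|->];
  rewrite ?sign_scaleK scaler0.
Qed.

Lemma shift_boundary k X n (x : shift k X n) :
  @is_boundary R (shift k X) n x <-> @is_boundary R X (n - k) x.
Proof.
rewrite /is_boundary /= /shift_diff /= [n - k + 1]addrAC.
by split=> -[y ->]; exists ((-1) ^+ `|k|%N *: y);
  rewrite linearZ /= ?sign_scaleK.
Qed.

Lemma quasi_iso_shift k X Y (s : chmap X Y) :
  quasi_iso s -> quasi_iso (shift_map k s).
Proof.
move=> qs n; have [inj surj] := qs (n - k); split.
  by move=> x /shift_cycle cx /shift_boundary bx; apply/shift_boundary/inj.
move=> y /shift_cycle cy; have [x cx bx] := surj _ cy.
by exists x; [apply/shift_cycle | apply/shift_boundary].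
Qed.

End Shift.

Section Cone.
Variable R : comPzRingType.

(* The identity M i -> M j when i = j, and zero otherwise. *)
Definition transport_deg (M : int -> lmodType R) (i j : int) :
    {linear M i -> M j} :=
  match i =P j with
  | ReflectT e => ecast l {linear M i -> M l} e idfun
  | ReflectF _ => \0
  end.

Lemma transport_deg_id (M : int -> lmodType R) i x : transport_deg M i i x = x.
Proof.
by rewrite /transport_deg; case: eqP => // e; rewrite (eq_axiomK e).
Qed.

Lemma transport_deg_neq (M : int -> lmodType R) i j x :
  i != j -> transport_deg M i j x = 0.
Proof. by rewrite /transport_deg; case: eqP. Qed.

Variables (X Y : complex R) (f : chmap X Y).

(* Cone_i = X_(i - 1) (+) Y_i with d (x, y) = (- d x, d y + f x); the last term
   f x lies in Y_(i - 1), which is Y_j exactly when d i j can be nonzero. *)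
Definition cone_diff (i j : int) (z : (X (i - 1) * Y i)%type) :
    (X (j - 1) * Y j)%type :=
  (- diff X (i - 1) (j - 1) z.1,
   diff Y i j z.2 + transport_deg Y (i - 1) j (f (i - 1) z.1)).

Lemma cone_diff_linear i j : linear (@cone_diff i j).
Proof.
move=> a [x y] [x' y']; rewrite /cone_diff /=; congr (_, _).
  by rewrite linearP opprD -scalerN.
by rewrite !linearP /= scalerDr addrACA.
Qed.

HB.instance Definition _ i j :=
  GRing.isLinear.Build R _ _ _ (@cone_diff i j) (@cone_diff_linear i j).

Lemma cone_diff_shape i j z : i != j + 1 -> @cone_diff i j z = 0.
Proof.
move=> ij; have ij1 : i - 1 != j by rewrite subr_eq.
by rewrite /cone_diff !diff_shape ?subrK // transport_deg_neq // oppr0 addr0.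
Qed.

Lemma cone_diff_diff i j k z : @cone_diff j k (@cone_diff i j z) = 0.
Proof.
rewrite /cone_diff /= linearN diff_diff !oppr0 linearD diff_diff add0r.
congr (_, _); rewrite !linearN /=; apply/eqP; rewrite subr_eq0; apply/eqP.
have [e|ij] := eqVneq (i - 1) j; last first.
  rewrite transport_deg_neq // linear0 diff_shape ?subrK -?subr_eq //.
  by rewrite !linear0.
subst j; rewrite transport_deg_id chfun_diff.
have [e|jk] := eqVneq (i - 1 - 1) k; first by subst k; rewrite transport_deg_id.
by rewrite transport_deg_neq // diff_shape // -subr_eq.
Qed.

Definition cone : complex R :=
  @Complex R (fun i => (X (i - 1) * Y i)%type) (fun i j => @cone_diff i j)
    cone_diff_shape cone_diff_diff.

Definition cone_in_fun i (y : Y i) : cone i := (0, y).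

Lemma cone_in_linear i : linear (@cone_in_fun i).
Proof.
move=> a x y; rewrite /cone_in_fun; apply: (congr2 pair) => //=.
by rewrite scaler0 addr0.
Qed.

HB.instance Definition _ i :=
  GRing.isLinear.Build R _ _ _ (@cone_in_fun i) (@cone_in_linear i).

Lemma cone_in_diff i j y :
  cone_in_fun (diff Y i j y) = diff cone i j (cone_in_fun y).
Proof. by rewrite /= /cone_diff /= !linear0 addr0. Qed.

Definition cone_in : chmap Y cone :=
  @ChMap R Y cone (fun i => @cone_in_fun i) cone_in_diff.

Definition cone_out_fun i (z : cone i) : shift 1 X i := z.1.

Lemma cone_out_linear i : linear (@cone_out_fun i).
Proof. by []. Qed.

HB.instance Definition _ i :=
  GRing.isLinear.Build R _ _ _ (@cone_out_fun i) (@cone_out_linear i).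

Lemma cone_out_diff i j z :
  cone_out_fun (diff cone i j z) = diff (shift 1 X) i j (cone_out_fun z).
Proof. by rewrite /= /shift_diff /= expr1 scaleN1r. Qed.

Definition cone_out : chmap cone (shift 1 X) :=
  @ChMap R cone (shift 1 X) (fun i => @cone_out_fun i) cone_out_diff.

End Cone.

(* The derived category D(R) is the localization of the homotopy category of
   complexes at the quasi-isomorphisms: morphisms are formal composites of chain
   maps and formal inverses of quasi-isomorphisms, and deq is their equality,
   the least congruence imposing the category axioms, functoriality of
   chain maps, homotopy invariance, and invertibility of quasi-isomorphisms. *)
Inductive dhom (R : comPzRingType) : complex R -> complex R -> Type :=
| dmap X Y (f : chmap X Y) : dhom X Y
| dinv X Y (s : chmap X Y) (qs : quasi_iso s) : dhom Y X
| dcomp X Y Z (g : dhom Y Z) (f : dhom X Y) : dhom X Z.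

Definition did (R : comPzRingType) (X : complex R) : dhom X X := dmap (chid X).

Definition dzero (R : comPzRingType) (X Y : complex R) : dhom X Y :=
  dmap (chzero X Y).

Inductive deq (R : comPzRingType) :
    forall X Y : complex R, dhom X Y -> dhom X Y -> Prop :=
| deq_refl X Y (f : dhom X Y) : deq f f
| deq_sym X Y (f g : dhom X Y) : deq f g -> deq g f
| deq_trans X Y (f g h : dhom X Y) : deq f g -> deq g h -> deq f h
| deq_comp X Y Z (g g' : dhom Y Z) (f f' : dhom X Y) :
    deq g g' -> deq f f' -> deq (dcomp g f) (dcomp g' f')
| deq_assoc X Y Z W (h : dhom Z W) (g : dhom Y Z) (f : dhom X Y) :
    deq (dcomp h (dcomp g f)) (dcomp (dcomp h g) f)
| deq_idl X Y (f : dhom X Y) : deq (dcomp (did Y) f) f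
| deq_idr X Y (f : dhom X Y) : deq (dcomp f (did X)) f
| deq_map_comp X Y Z (g : chmap Y Z) (f : chmap X Y) :
    deq (dmap (chcomp g f)) (dcomp (dmap g) (dmap f))
| deq_homotopic X Y (f g : chmap X Y) : homotopic f g -> deq (dmap f) (dmap g)
| deq_invr X Y (s : chmap X Y) (qs : quasi_iso s) :
    deq (dcomp (dmap s) (dinv qs)) (did Y)
| deq_invl X Y (s : chmap X Y) (qs : quasi_iso s) :
    deq (dcomp (dinv qs) (dmap s)) (did X).

Fixpoint dshift (R : comPzRingType) (k : int) (X Y : complex R) (f : dhom X Y) :
    dhom (shift k X) (shift k Y) :=
  match f in dhom X' Y' return dhom (shift k X') (shift k Y') with
  | dmap _ _ f => dmap (shift_map k f)
  | dinv _ _ _ qs => dinv (quasi_iso_shift k qs)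
  | dcomp _ _ _ g f => dcomp (dshift k g) (dshift k f)
  end.

Definition diso (R : comPzRingType) (X Y : complex R) (f : dhom X Y) : Prop :=
  exists g : dhom Y X, deq (dcomp g f) (did X) /\ deq (dcomp f g) (did Y).

Definition dretract (R : comPzRingType) (X Y : complex R) : Prop :=
  exists (i : dhom X Y) (r : dhom Y X), deq (dcomp r i) (did X).

(* X -> Y -> Z -> Sigma X is exact when it is isomorphic in D(R) to the
   standard triangle A -> B -> cone u -> Sigma A of a chain map u. *)
Definition exact_triangle (R : comPzRingType) (X Y Z : complex R)
    (f : dhom X Y) (g : dhom Y Z) (h : dhom Z (shift 1 X)) : Prop :=
  exists (A B : complex R) (u : chmap A B)
         (a : dhom A X) (b : dhom B Y) (c : dhom (cone u) Z),
    [/\ diso a, diso b & diso c] /\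
    [/\ deq (dcomp b (dmap u)) (dcomp f a),
        deq (dcomp c (dmap (cone_in u))) (dcomp g b)
      & deq (dcomp (dshift 1 a) (dmap (cone_out u))) (dcomp h c)].

Record is_thick (R : comPzRingType) (P : complex R -> Prop) : Prop := IsThick {
  thick_suspension : forall X, P X -> P (shift 1 X);
  thick_desuspension : forall X, P X -> P (shift (-1) X);
  thick_retract : forall X Y, dretract X Y -> P Y -> P X;
  thick_triangle : forall X Y Z f g h, @exact_triangle R X Y Z f g h ->
    [/\ P X -> P Y -> P Z, P Y -> P Z -> P X & P X -> P Z -> P Y] }.

Definition thick_closure (R : comPzRingType) (S X : complex R) : Prop :=
  forall P : complex R -> Prop, is_thick P -> P S -> P X.

(* The complex S: R in degree zero and 0 (= 'rV_0) elsewhere. *)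
Definition sphere_obj (R : comPzRingType) (i : int) : lmodType R :=
  if i == 0 then (R^o : lmodType R) else ('rV[R]_0 : lmodType R).

Definition sphere (R : comPzRingType) : complex R :=
  @Complex R (sphere_obj R) (fun i j => \0)
    (fun i j x _ => erefl) (fun i j k x => erefl).

(* pi_i f = 0, where pi_i X = Hom (Sigma^i S, X). *)
Definition pi_zero (R : comPzRingType) (X Y : complex R) (f : dhom X Y) (i : int)
    : Prop :=
  forall a : dhom (shift i (sphere R)) X,
    deq (dcomp f a) (dzero (shift i (sphere R)) Y).

Definition generating_hypothesis (R : comPzRingType) : Prop :=
  forall (X Y : complex R) (f : dhom X Y),
    thick_closure (sphere R) X -> thick_closure (sphere R) Y ->
    (forall i, pi_zero f i) -> deq f (dzero X Y).

Definition von_neumann_regular (R : comPzRingType) : Prop :=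
  forall x : R, exists y : R, x * y * x = x.

(* Main.v *)
Require Import Defs.
From HB Require Import structures.
From mathcomp Require Import all_boot all_order all_algebra.
From mathcomp Require Import boolp.

(** Regularity of R implies the generating hypothesis because perfect complexes
    then split.  Every matrix A over a von Neumann regular ring satisfies
    A B A = A for some B ([von_neumann_regular_mx]), so a map between finitely
    generated projective modules has projective kernel, image and cokernel, and
    the middle term of a five-term exact sequence with finitely generated
    projective outer terms is of the same kind ([fgproj_five]).  Fed with the
    long exact sequence of a cone, this shows that the complexes all of whose
    homology modules are finitely generated projective form a thick subcategory;
    it contains S, hence thick<S>.  If X is such a complex, sections of the maps
    Z_n X -> H_n X assemble into a quasi-isomorphism H_* X -> X from a complex
    with zero differential ([homology_model]).  Morphisms in D(R) out of H_* X
    are homotopy classes of chain maps, and such a chain map is null-homotopic as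
    soon as it vanishes on homology, since a null-homotopy is a lift through the
    boundary map of the target.

    Conversely, the hypothesis is tested on two small complexes of free modules.
    If x^2 = 0, multiplication by x on P = (R -x-> R -x-> R) kills homology: a
    cycle in degree 2 or 1 is annihilated by x, and every x c in degree 0 is a
    boundary.  A null-homotopy of it, with components b0 and a1,
    satisfies x = x b0, x = x a1 + x b0 and x = x a1 in degrees 0, 1 and 2,
    whence x = x + x and x = 0.  So R is reduced.  For arbitrary x, consider the
    map from (R -x^2-> R) to Sigma R which is x on the top cell.  On homology it
    is multiplication by x on the annihilator of x^2, which is the annihilator
    of x because R is reduced; so it is null-homotopic, which means that x is a
    multiple of x^2.

    Both directions have to decide when a formal composite of chain maps and
    inverted quasi-isomorphisms is zero.  A complex P is K-projective when every
    chain map from P to an acyclic complex is null-homotopic; then the homotopy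
    classes of chain maps out of P form a functor that inverts
    quasi-isomorphisms, so D(R)-morphisms out of P are the same as homotopy
    classes ([kproj_full], [kproj_faithful]).  Complexes of finitely generated
    projective modules with zero differential are K-projective
    ([kproj_zero_diff]), and K-projectivity passes to cones ([kproj_cone]). *)

Set Implicit Arguments.
Unset Strict Implicit.
Unset Printing Implicit Defensive.

Import GRing.Theory.
Local Open Scope ring_scope.

(** * Regular matrices and finitely generated projective modules *)

Section RegularMatrices.
Variable R : comPzRingType.

Definition regular_mx m n (A : 'M[R]_(m, n)) : Prop :=
  exists B : 'M[R]_(n, m), A *m B *m A = A.

Lemma regular_mx_tr m n (A : 'M[R]_(m, n)) : regular_mx A^T -> regular_mx A.
Proof.
move=> [B eB]; exists B^T; apply: trmx_inj.
by rewrite !trmx_mul trmxK mulmxA.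
Qed.

(** McCoy's reduction: regularity may be checked after subtracting from A any
    approximation A Y A of it. *)
Lemma regular_mx_sub m n (A : 'M[R]_(m, n)) (Y : 'M[R]_(n, m)) :
  regular_mx (A - A *m Y *m A) -> regular_mx A.
Proof.
move=> [Z eZ]; exists (Y + (1%:M - Y *m A) *m Z *m (1%:M - A *m Y)).
have eA : A *m (1%:M - Y *m A) = A - A *m Y *m A.
  by rewrite mulmxBr mulmx1 mulmxA.
rewrite (mulmxDr A) (mulmxDl (A *m Y)) !mulmxA eA -(mulmxA _ (1%:M - _)).
rewrite (mulmxBl 1%:M) mul1mx eZ.
by rewrite addrC subrK.
Qed.

(** For M with first row a and remaining rows A, and Y = (b 0), the matrix M Y M
    has the same first row as M; after the subtraction only the lower block
    remains. *)
Lemma regular_col_mx m n (a : 'rV[R]_n) (A : 'M[R]_(m, n)) (b : 'cV[R]_n) :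
    a *m b *m a = a -> regular_mx (A - A *m b *m a) ->
  regular_mx (col_mx a A).
Proof.
move=> ab [B eB]; apply: (@regular_mx_sub _ _ _ (row_mx b 0)).
have -> : col_mx a A - col_mx a A *m row_mx b 0 *m col_mx a A =
          col_mx 0 (A - A *m b *m a).
  rewrite mul_mx_row mulmx0 mul_row_col mul0mx addr0 !mul_col_mx.
  by rewrite opp_col_mx add_col_mx ab subrr.
exists (row_mx 0 B).
rewrite mul_mx_row mulmx0 mul_row_col mul0mx add0r.
by rewrite !mul_col_mx !mul0mx eB.
Qed.

Lemma regular_mx_rows n :
    (forall a : 'rV[R]_n, regular_mx a) ->
  forall m (A : 'M[R]_(m, n)), regular_mx A.
Proof.
move=> reg1; elim=> [|m IHm] A; first by exists 0; rewrite !flatmx0.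
rewrite -[A](@vsubmxK _ 1 m); have [b eb] := reg1 (usubmx (A : 'M_(1 + m, n))).
exact: regular_col_mx eb (IHm _).
Qed.

(** Two inductions on the number of rows, separated by a transposition, bring an
    arbitrary matrix down to a 1 x 1 matrix. *)
Lemma von_neumann_regular_mx :
  von_neumann_regular R -> forall m n (A : 'M[R]_(m, n)), regular_mx A.
Proof.
move=> regR m n; apply: regular_mx_rows => a; apply: regular_mx_tr.
apply: regular_mx_rows => {}a; have [y ey] := regR (a 0 0).
exists y%:M; rewrite [a]mx11_scalar -!scalar_mxM.
by rewrite ey.
Qed.

End RegularMatrices.

Section Modules.
Variable R : comPzRingType.
Implicit Types U V W M N : lmodType R.

Definition linear_map U V (f : U -> V) (lf : linear f) : {linear U -> V} :=
  HB.pack f (GRing.isLinear.Build R U V *:%R f lf).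

Definition fgproj M : Prop :=
  exists k (i : {linear M -> 'rV[R]_k}) (r : {linear 'rV[R]_k -> M}),
    cancel i r.

Lemma fgproj_retract M N (i : {linear M -> N}) (r : {linear N -> M}) :
  cancel i r -> fgproj N -> fgproj M.
Proof.
move=> ir [k [j [s js]]].
by exists k, (j \o i), (r \o s) => x; rewrite /= js ir.
Qed.

Lemma fgproj_free k : fgproj 'rV[R]_k.
Proof. by exists k, idfun, idfun. Qed.

Lemma fgproj_ring : fgproj R^o.
Proof.
pose i (x : R^o) : 'rV[R]_1 := x%:M.
have li : linear i by move=> a x y; apply/rowP => j; rewrite !mxE ord1.
pose r (v : 'rV[R]_1) : R^o := v 0 0.
have lr : linear r by move=> a x y; rewrite /r !mxE.
apply: (@fgproj_retract _ _ (linear_map li) (linear_map lr)) (fgproj_free 1).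
by move=> x; rewrite /= /r /i mxE mulr1n.
Qed.

Lemma fgproj_pair M N : fgproj M -> fgproj N -> fgproj (M * N)%type.
Proof.
move=> [k [i [r ir]]] [l [j [s js]]].
pose f (z : (M * N)%type) : 'rV[R]_(k + l) := row_mx (i z.1) (j z.2).
have lf : linear f.
  by move=> a x y; rewrite /f !linearP /= scale_row_mx add_row_mx.
pose g (v : 'rV[R]_(k + l)) : (M * N)%type := (r (lsubmx v), s (rsubmx v)).
have lg : linear g by move=> a x y; rewrite /g !linearP.
exists (k + l)%N, (linear_map lf), (linear_map lg) => -[x y].
by rewrite /= /f /g row_mxKl row_mxKr ir js.
Qed.

(** Projectivity for maps that need not be surjective: f lifts through g as soon
    as it does so pointwise. *)
Lemma fgproj_lift M V W (g : {linear V -> W}) (f : {linear M -> W}) :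
    fgproj M -> (forall x, exists v, g v = f x) ->
  exists h : {linear M -> V}, forall x, g (h x) = f x.
Proof.
move=> [k [i [r ir]]] fg.
have [v ev] : exists v : 'I_k -> V, forall j, g (v j) = f (r (delta_mx 0 j)).
  by have [v ev] := choice (fun j => fg (r (delta_mx 0 j))); exists v.
pose h (u : 'rV[R]_k) := \sum_j u 0 j *: v j.
have lh : linear h.
  move=> a x y; rewrite /h scaler_sumr -big_split /=; apply: eq_bigr => j _.
  by rewrite !mxE scalerDl scalerA.
exists (linear_map lh \o i) => x.
rewrite /= /h linear_sum -{2}[x]ir [i x in RHS]row_sum_delta !linear_sum /=.
by apply: eq_bigr => j _; rewrite !linearZ /= ev.
Qed.

(** Extend f by zero to a map of free modules and compress a pseudo-inverse of
    its matrix; in particular the kernel and image of f are direct summands. *)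
Lemma fgproj_pseudo_inverse M N (f : {linear M -> N}) :
    von_neumann_regular R -> fgproj M -> fgproj N ->
  exists g : {linear N -> M}, forall x, f (g (f x)) = f x.
Proof.
move=> regR [k [i [r ir]]] [l [j [s js]]].
have [B eB] := von_neumann_regular_mx regR (lin1_mx (j \o f \o r)).
exists (r \o mulmxr B \o j) => x.
have := congr1 (fun A => s (i x *m A)) eB.
by rewrite /= !mulmxA !mul_rV_lin1 /= !js !ir.
Qed.

Definition exact_at U V W (f : {linear U -> V}) (g : {linear V -> W}) : Prop :=
  forall y, g y = 0 <-> exists x, y = f x.

(** The kernel of d is a summand of D, and c maps C onto it with a section sg;
    the image of a is a summand of B, so its complement embeds in C through b,
    with inverse ta on the kernel of c.  Hence y = b (ta y) + sg (c y), and C is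
    a retract of B x D. *)
Lemma fgproj_five (A B C D E : lmodType R) (a : {linear A -> B})
    (b : {linear B -> C}) (c : {linear C -> D}) (d : {linear D -> E}) :
    von_neumann_regular R -> exact_at a b -> exact_at b c -> exact_at c d ->
    fgproj A -> fgproj B -> fgproj D -> fgproj E ->
  fgproj C.
Proof.
move=> regR exB exC exD pA pB pD pE.
have [a' aK] := fgproj_pseudo_inverse a regR pA pB.
have [d' dK] := fgproj_pseudo_inverse d regR pD pE.
have [sg csg] : exists sg : {linear D -> C}, forall x, c (sg x) = x - d' (d x).
  apply: (@fgproj_lift _ _ _ c (idfun \- (d' \o d))) => // x /=.
  have /exD[y ->] : d (x - d' (d x)) = 0 by rewrite linearB /= dK subrr.
  by exists y.
have csgc y : c (y - sg (c y)) = 0.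
  have /exD dc : exists z, c y = c z by exists y.
  by rewrite linearB /= csg dc linear0 subr0 subrr.
have [ta0 ta0E] := choice (fun y => (exC _).1 (csgc y)).
pose ta y := ta0 y - a (a' (ta0 y)).
have b0 x : b (a x) = 0 by apply/exB; exists x.
(* ta y depends only on y: two preimages under b differ by an element of the
   image of a, which 1 - a a' kills. *)
have taP y z : y - sg (c y) = b z -> ta y = z - a (a' z).
  move=> e; have /exB[w ew] : b (ta0 y - z) = 0.
    by rewrite linearB /= -ta0E e subrr.
  have {}ew : ta0 y = a w + z by rewrite -ew subrK.
  by rewrite /ta ew (linearD a') (linearD a) /= aK opprD addrACA subrr add0r.
have lta : linear ta.
  move=> r x y; rewrite (taP _ (r *: ta0 x + ta0 y)); last first.
    rewrite (linearP c) (linearP sg) (linearP b) /= -!ta0E.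
    by rewrite scalerBr opprD addrACA.
  by rewrite (linearP a') (linearP a) /= /ta scalerBr opprD addrACA.
pose i y := (ta y, c y).
have li : linear i by move=> r x y; rewrite /i lta linearP.
pose r (z : (B * D)%type) := b z.1 + sg z.2.
have lr : linear r by move=> q x y; rewrite /r !linearP /= scalerDr addrACA.
apply: (@fgproj_retract _ _ (linear_map li) (linear_map lr)) (fgproj_pair pB pD).
by move=> y; rewrite /= /r /= /ta linearB /= b0 subr0 -ta0E subrK.
Qed.

End Modules.

(** * Kernels and cokernels of linear maps *)

Section Kernel.
Variables (R : comPzRingType) (V W : lmodType R) (f : {linear V -> W}).

Definition kernel_pred x := f x == 0.

Lemma kernel_submod_closed : subsemimod_closed kernel_pred.
Proof.
split; first split.
- exact/eqP/linear0.
- by move=> x y /eqP fx /eqP fy; apply/eqP; rewrite linearD /= fx fy addr0.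
- by move=> a x /eqP fx; apply/eqP; rewrite linearZ /= fx scaler0.
Qed.

HB.instance Definition _ :=
  GRing.isSubmodClosed.Build R V kernel_pred kernel_submod_closed.

Record kernel := Kernel { kernel_val : V; kernel_valP : kernel_pred kernel_val }.
HB.instance Definition _ := [isSub for kernel_val].
HB.instance Definition _ := [Choice of kernel by <:].
HB.instance Definition _ := [SubChoice_isSubLmodule of kernel by <:].

Lemma kernelK (z : kernel) : f (\val z) = 0.
Proof. exact/eqP/(valP z). Qed.
End Kernel.

Section Cokernel.
Variables (R : comPzRingType) (U V : lmodType R) (g : {linear U -> V}).

Definition image_pred v := `[< exists u, v = g u >].

Lemma image_submod_closed : subsemimod_closed image_pred.
Proof.
split; first split.
- by apply/asboolP; exists 0; rewrite linear0.
- move=> x y /asboolP[u ->] /asboolP[v ->]; apply/asboolP.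
  by exists (u + v); rewrite linearD.
- by move=> a x /asboolP[u ->]; apply/asboolP; exists (a *: u); rewrite linearZ.
Qed.

HB.instance Definition _ :=
  GRing.isSubmodClosed.Build R V image_pred image_submod_closed.

Definition cokernel := Quotient.quot (GRing.ZmodClosed.clone V image_pred _).
HB.instance Definition _ := GRing.Zmodule.on cokernel.

Definition coker_class v : cokernel := \pi_(cokernel)%qT v.

Lemma coker_class_surj c : exists v, c = coker_class v.
Proof. by exists (repr c); rewrite /coker_class reprK. Qed.

Lemma coker_class_eq x y :
  coker_class x = coker_class y <-> exists u, x = y + g u.
Proof.
split=> [/eqP|].
  rewrite -Quotient.idealrBE => /asboolP[u e]; exists u.
  by rewrite -e addrC subrK.
move=> [u ->]; apply/eqP; rewrite -Quotient.idealrBE.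
by apply/asboolP; exists u; rewrite addrC addKr.
Qed.

Lemma coker_classD x y : coker_class (x + y) = coker_class x + coker_class y.
Proof. by rewrite /coker_class !piE. Qed.

Definition coker_scale a (c : cokernel) : cokernel :=
  coker_class (a *: repr c).

Lemma coker_scale_class a x :
  coker_scale a (coker_class x) = coker_class (a *: x).
Proof.
apply/coker_class_eq.
have /coker_class_eq[u ->] := reprK (coker_class x).
by exists (a *: u); rewrite scalerDr linearZ.
Qed.

Lemma coker_scaleA a b c :
  coker_scale a (coker_scale b c) = coker_scale (a * b) c.
Proof.
by have [x ->] := coker_class_surj c; rewrite !coker_scale_class scalerA.
Qed.

Lemma coker_scale1 : left_id 1 coker_scale.
Proof.
by move=> c; have [x ->] := coker_class_surj c; rewrite coker_scale_class scale1r.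
Qed.

Lemma coker_scaleDr : right_distributive coker_scale +%R.
Proof.
move=> a c d; have [x ->] := coker_class_surj c.
have [y ->] := coker_class_surj d.
by rewrite -coker_classD !coker_scale_class scalerDr coker_classD.
Qed.

Lemma coker_scaleDl c : {morph coker_scale^~ c : a b / a + b}.
Proof.
move=> a b; have [x ->] := coker_class_surj c.
by rewrite !coker_scale_class scalerDl coker_classD.
Qed.

HB.instance Definition _ := GRing.Zmodule_isLmodule.Build R cokernel
  coker_scaleA coker_scale1 coker_scaleDr coker_scaleDl.

Lemma coker_class_linear : linear coker_class.
Proof. by move=> a x y; rewrite coker_classD -coker_scale_class. Qed.

HB.instance Definition _ :=
  GRing.isLinear.Build R _ _ _ coker_class coker_class_linear.

Lemma coker_class_eq0 v : coker_class v = 0 <-> exists u, v = g u.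
Proof.
rewrite -[0](linear0 coker_class); split.
  by move=> /coker_class_eq[u]; rewrite add0r; exists u.
by move=> [u ->]; apply/coker_class_eq; exists u; rewrite add0r.
Qed.

Lemma coker_factor (W : lmodType R) (f : {linear V -> W}) :
    (forall u, f (g u) = 0) ->
  exists h : {linear cokernel -> W}, forall v, h (coker_class v) = f v.
Proof.
move=> fg; pose h (c : cokernel) := f (repr c).
have hE v : h (coker_class v) = f v.
  rewrite /h; have /coker_class_eq[u ->] := reprK (coker_class v).
  by rewrite linearD /= fg addr0.
have lh : linear h.
  move=> a c d; have [x ->] := coker_class_surj c.
  by have [y ->] := coker_class_surj d; rewrite -linearP !hE linearP.
by exists (linear_map lh).
Qed.

End Cokernel.

(** * Homology as a functor on the derived category *)

Section Transport.
Variable R : comPzRingType.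
Implicit Types X Y : complex R.

Lemma diff_transport X i j k (x : X i) :
  i = j -> diff X j k (transport_deg X i j x) = diff X i k x.
Proof. by move=> e; subst j; rewrite transport_deg_id. Qed.

Lemma transport_diff X i j k (x : X i) :
  j = k -> transport_deg X j k (diff X i j x) = diff X i k x.
Proof. by move=> e; subst k; rewrite transport_deg_id. Qed.

Lemma chmap_transport X Y (f : chmap X Y) i j (x : X i) :
  f j (transport_deg X i j x) = transport_deg Y i j (f i x).
Proof.
have [e|ij] := eqVneq i j; first by subst j; rewrite !transport_deg_id.
by rewrite !transport_deg_neq // linear0.
Qed.

Lemma transport_trans (M : int -> lmodType R) i j k (x : M i) :
  i = j -> transport_deg M j k (transport_deg M i j x) = transport_deg M i k x.
Proof. by move=> e; subst j; rewrite transport_deg_id. Qed.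

Lemma transport_deg_eq (M : int -> lmodType R) i j (x : M i) :
  i = j -> transport_deg M j i (transport_deg M i j x) = x.
Proof. by move=> e; rewrite transport_trans // transport_deg_id. Qed.

Lemma transport_deg_family (M : int -> lmodType R) (x : forall i, M i) i j :
  i = j -> transport_deg M i j (x i) = x j.
Proof. by move=> e; subst j; rewrite transport_deg_id. Qed.

End Transport.

Lemma linear_inverse (R : comPzRingType) (V W : lmodType R)
    (f : {linear V -> W}) :
    (forall x, f x = 0 -> x = 0) -> (forall y, exists x, f x = y) ->
  exists g : {linear W -> V}, cancel f g /\ cancel g f.
Proof.
move=> f0 fsurj; have [g gK] := choice fsurj.
have fK : cancel f g.
  move=> x; apply/eqP; rewrite -subr_eq0; apply/eqP/f0.
  by rewrite linearB /= gK subrr.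
have lg : linear g.
  by move=> a x y; rewrite -[RHS]fK linearP /= !gK.
by exists (linear_map lg).
Qed.

Section Homology.
Variable R : comPzRingType.
Implicit Types X Y : complex R.

Definition cycle X n := kernel (diff X n (n - 1)).
HB.instance Definition _ X n := GRing.Lmodule.on (cycle X n).

Definition mkcycle X n (x : X n) (cx : is_cycle x) : cycle X n :=
  Kernel (introT eqP cx).

Lemma cycleP X n (z : cycle X n) : is_cycle (\val z).
Proof. exact: kernelK. Qed.

Lemma diff_cycle X n (y : X (n + 1)) : is_cycle (diff X (n + 1) n y).
Proof. exact: diff_diff. Qed.

Definition to_cycle X n (y : X (n + 1)) : cycle X n := mkcycle (diff_cycle y).

Lemma to_cycle_linear X n : linear (@to_cycle X n).
Proof. by move=> a x y; apply: val_inj; rewrite /= linearP. Qed.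

HB.instance Definition _ X n :=
  GRing.isLinear.Build R _ _ _ (@to_cycle X n) (@to_cycle_linear X n).

Definition homology X n := cokernel (@to_cycle X n).
HB.instance Definition _ X n := GRing.Lmodule.on (homology X n).

Definition hclass X n : {linear cycle X n -> homology X n} :=
  @coker_class R _ _ (@to_cycle X n).

Lemma hclass_surj X n (c : homology X n) : exists z, c = hclass X n z.
Proof. exact: coker_class_surj. Qed.

Lemma hclass_eq0 X n (z : cycle X n) : hclass X n z = 0 <-> is_boundary (\val z).
Proof.
split=> [/coker_class_eq0[y ->]|[y ey]]; first by exists y.
by apply/coker_class_eq0; exists y; apply: val_inj; rewrite ey.
Qed.

Lemma hclass_eq X n (z w : cycle X n) :
  hclass X n z = hclass X n w <-> is_boundary (\val z - \val w).
Proof.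
rewrite -[\val z - \val w]/(\val (z - w)) -hclass_eq0 linearB /=.
by split=> [->|/eqP]; rewrite ?subrr // subr_eq0 => /eqP.
Qed.

Lemma homology_factor X n (W : lmodType R) (f : {linear cycle X n -> W}) :
    (forall z, is_boundary (\val z) -> f z = 0) ->
  exists h : {linear homology X n -> W}, forall z, h (hclass X n z) = f z.
Proof. by move=> f0; apply: coker_factor => y; apply: f0; exists y. Qed.

Lemma chmap_cycle X Y (f : chmap X Y) n (x : X n) :
  is_cycle x -> is_cycle (f n x).
Proof. by rewrite /is_cycle -chfun_diff => ->; rewrite linear0. Qed.

Lemma chmap_boundary X Y (f : chmap X Y) n (x : X n) :
  is_boundary x -> is_boundary (f n x).
Proof. by move=> [y ->]; exists (f (n + 1) y); rewrite chfun_diff. Qed.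

Definition cycle_map X Y (f : chmap X Y) n (z : cycle X n) : cycle Y n :=
  mkcycle (chmap_cycle f (cycleP z)).

Lemma cycle_map_linear X Y (f : chmap X Y) n : linear (@cycle_map X Y f n).
Proof. by move=> a x y; apply: val_inj; rewrite /= linearP. Qed.

HB.instance Definition _ X Y f n :=
  GRing.isLinear.Build R _ _ _ (@cycle_map X Y f n) (@cycle_map_linear X Y f n).

Lemma homology_map_ex X Y (f : chmap X Y) n :
  exists h : {linear homology X n -> homology Y n},
    forall z, h (hclass X n z) = hclass Y n (cycle_map f z).
Proof.
apply: (homology_factor (f := hclass Y n \o @cycle_map X Y f n)) => z bz /=.
by apply/hclass_eq0; apply: chmap_boundary.
Qed.

Definition homology_map X Y (f : chmap X Y) n :=
  projT1 (cid (homology_map_ex f n)).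

Lemma homology_mapE X Y (f : chmap X Y) n z :
  homology_map f n (hclass X n z) = hclass Y n (cycle_map f z).
Proof. exact: (projT2 (cid (homology_map_ex f n))). Qed.

Lemma homology_inv_ex X Y (s : chmap X Y) (qs : quasi_iso s) n :
  exists h : {linear homology Y n -> homology X n},
    cancel (homology_map s n) h /\ cancel h (homology_map s n).
Proof.
have [inj surj] := qs n; apply: linear_inverse => c.
  have [z ->] := hclass_surj c; rewrite homology_mapE => /hclass_eq0 bz.
  by apply/hclass_eq0/inj => //; apply: cycleP.
have [z ->] := hclass_surj c; have [x cx bx] := surj _ (cycleP z).
exists (hclass X n (mkcycle cx)); rewrite homology_mapE.
by apply/esym/hclass_eq.
Qed.

Definition homology_inv X Y (s : chmap X Y) (qs : quasi_iso s) n :=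
  projT1 (cid (homology_inv_ex qs n)).

Lemma homology_mapK X Y (s : chmap X Y) (qs : quasi_iso s) n :
  cancel (homology_map s n) (homology_inv qs n).
Proof. by have [] := projT2 (cid (homology_inv_ex qs n)). Qed.

Lemma homology_invK X Y (s : chmap X Y) (qs : quasi_iso s) n :
  cancel (homology_inv qs n) (homology_map s n).
Proof. by have [] := projT2 (cid (homology_inv_ex qs n)). Qed.

(** Formal inverses of quasi-isomorphisms act by the inverse of the induced
    isomorphism, so homology is defined on representatives of morphisms. *)
Fixpoint dhomology X Y (f : dhom X Y) n : {linear homology X n -> homology Y n} :=
  match f with
  | dmap _ _ f => homology_map f n
  | dinv _ _ _ qs => homology_inv qs n
  | dcomp _ _ _ g f => dhomology g n \o dhomology f n
  end.

(** Each generating relation of the derived category holds in homology. *)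
Lemma deq_homology X Y (f g : dhom X Y) :
  deq f g -> forall n, dhomology f n =1 dhomology g n.
Proof.
elim=> {X Y f g}.
- by [].
- by move=> X Y f g _ IH n x; rewrite IH.
- by move=> X Y f g h _ IH1 _ IH2 n x; rewrite IH1 IH2.
- by move=> X Y Z g g' f f' _ IHg _ IHf n x /=; rewrite IHf IHg.
- by [].
- move=> X Y f n x /=; have [z ->] := hclass_surj (dhomology f n x).
  by rewrite homology_mapE; congr (hclass _ _ _); apply: val_inj.
- move=> X Y f n x /=; have [z ->] := hclass_surj x.
  by rewrite homology_mapE; congr (dhomology f n (hclass X n _)); apply: val_inj.
- move=> X Y Z g f n x /=; have [z ->] := hclass_surj x.
  by rewrite !homology_mapE; congr (hclass _ _ _); apply: val_inj.
- move=> X Y f g [h hE] n x /=; have [z ->] := hclass_surj x.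
  rewrite !homology_mapE; apply/hclass_eq; rewrite /= hE cycleP linear0 addr0.
  by exists (h n (n + 1) (\val z)).
- move=> X Y s qs n x /=; rewrite homology_invK; have [z ->] := hclass_surj x.
  by rewrite homology_mapE; congr (hclass _ _ _); apply: val_inj.
- move=> X Y s qs n x /=; rewrite homology_mapK; have [z ->] := hclass_surj x.
  by rewrite homology_mapE; congr (hclass _ _ _); apply: val_inj.
Qed.

Lemma dhomology_id X n x : dhomology (did X) n x = x.
Proof.
have [z ->] := hclass_surj x.
by rewrite /= homology_mapE; congr (hclass _ _ _); apply: val_inj.
Qed.

Definition fgproj_homology X : Prop := forall n, fgproj (homology X n).

Lemma fgproj_homology_retract X Y :
  dretract X Y -> fgproj_homology Y -> fgproj_homology X.
Proof.
move=> [i [r ri]] pY n.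
apply: (fgproj_retract (i := dhomology i n) (r := dhomology r n)) (pY n) => x.
by have := deq_homology ri x; rewrite /= dhomology_id.
Qed.

Lemma diso_retract X Y (f : dhom X Y) : diso f -> dretract X Y /\ dretract Y X.
Proof. by move=> [g [gf fg]]; split; [exists f, g | exists g, f]. Qed.

(** Shifting changes the differential by a sign at most, hence neither cycles nor
    boundaries. *)
Lemma fgproj_homology_shift k X :
  fgproj_homology X -> fgproj_homology (shift k X).
Proof.
move=> pX n.
pose f (z : cycle (shift k X) n) : cycle X (n - k) :=
  mkcycle ((shift_cycle (\val z)).1 (cycleP z)).
have lf : linear f by move=> a x y; apply: val_inj.
pose g (z : cycle X (n - k)) : cycle (shift k X) n :=
  @mkcycle (shift k X) n (\val z) ((@shift_cycle R k X n (\val z)).2 (cycleP z)).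
have lg : linear g by move=> a x y; apply: val_inj.
have [|i iE] := homology_factor (f := hclass X (n - k) \o linear_map lf).
  by move=> z bz /=; apply/hclass_eq0/shift_boundary.
have [|r rE] := homology_factor (f := hclass (shift k X) n \o linear_map lg).
  by move=> z bz /=; apply/hclass_eq0/shift_boundary.
apply: (fgproj_retract (i := i) (r := r)) (pX (n - k)) => c.
have [z ->] := hclass_surj c; rewrite iE rE /=.
by congr (hclass _ _ _); apply: val_inj.
Qed.

End Homology.

(** * Long exact sequence and thickness *)

Section LongExactSequence.
Variables (R : comPzRingType) (A B : complex R) (u : chmap A B).

Lemma cone_cycleP n (z : cone u n) :
  @is_cycle R (cone u) n z <->
  @is_cycle R A (n - 1) z.1 /\
  diff B n (n - 1) z.2 = - u (n - 1) z.1.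
Proof.
rewrite /is_cycle /= /cone_diff /= transport_deg_id; split=> [[/eqP]|[-> ->]].
  by rewrite oppr_eq0 => /eqP -> /eqP; rewrite addr_eq0 => /eqP.
by rewrite oppr0 addNr.
Qed.

Lemma connecting_ex n :
  exists h : {linear homology (cone u) n -> homology A (n - 1)},
  forall z : cycle (cone u) n, forall c : is_cycle (\val z).1,
    h (hclass _ _ z) = hclass _ _ (mkcycle c).
Proof.
pose f (z : cycle (cone u) n) : cycle A (n - 1) :=
  mkcycle ((cone_cycleP (\val z)).1 (cycleP z)).1.
have lf : linear f by move=> a x y; apply: val_inj.
have [|h hE] := homology_factor (f := hclass A (n - 1) \o linear_map lf).
  move=> z [[a b] /= e]; apply/hclass_eq0; rewrite /= e /=.
  exists (transport_deg A (n + 1 - 1) (n - 1 + 1) (- a)).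
  by rewrite diff_transport 1?addrAC // linearN.
by exists h => z c; rewrite hE /=; congr (hclass _ _ _); apply: val_inj.
Qed.

Definition connecting n := projT1 (cid (connecting_ex n)).

Lemma connectingE n (z : cycle (cone u) n) (c : is_cycle (\val z).1) :
  connecting n (hclass _ _ z) = hclass _ _ (mkcycle c).
Proof. exact: (projT2 (cid (connecting_ex n))). Qed.

Lemma exact_cone_in n :
  exact_at (homology_map u n) (homology_map (cone_in u) n).
Proof.
move=> c; have [z ->] := hclass_surj c; rewrite homology_mapE; split.
  move=> /hclass_eq0[[a b] /= [e1 e2]].
  have ca : is_cycle (transport_deg A (n + 1 - 1) n a).
    apply/eqP; rewrite /is_cycle diff_transport ?addrK //.
    by rewrite -oppr_eq0 -e1.
  exists (hclass A n (mkcycle ca)); rewrite homology_mapE; apply/hclass_eq.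
  by exists b; rewrite /= e2 /= chmap_transport addrK.
move=> [a]; have [w ->] := hclass_surj a.
rewrite homology_mapE => /hclass_eq[b /= e].
apply/hclass_eq0.
exists (transport_deg A n (n + 1 - 1) (\val w), b).
have en : n = n + 1 - 1 by rewrite addrK.
rewrite /= /cone_diff /= diff_transport // (cycleP w) oppr0.
congr (_, _); rewrite chmap_transport transport_deg_eq //.
by rewrite -e subrK.
Qed.

Lemma exact_cone_out n :
  exact_at (homology_map (cone_in u) n) (connecting n).
Proof.
move=> c; have [z ->] := hclass_surj c.
have [ca eb] := (cone_cycleP (\val z)).1 (cycleP z).
rewrite (connectingE ca); split.
  move=> /hclass_eq0 /= [a ea].
  have en : n - 1 + 1 = n by rewrite subrK.
  pose b := (\val z).2 + transport_deg B (n - 1 + 1) n (u (n - 1 + 1) a).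
  have cb : is_cycle b.
    by rewrite /is_cycle linearD /= diff_transport // -chfun_diff -ea eb addNr.
  exists (hclass B n (mkcycle cb)); rewrite homology_mapE; apply/hclass_eq.
  exists (- transport_deg A (n - 1 + 1) (n + 1 - 1) a, 0) => /=.
  rewrite /cone_diff /= linear0 add0r !linearN /= diff_transport 1?addrAC //.
  rewrite opprK -ea chmap_transport transport_trans 1?addrAC //.
  by apply: (congr2 pair); rewrite /= ?subr0 // opprD addrA subrr add0r.
move=> [b]; have [w ->] := hclass_surj b; rewrite homology_mapE.
move=> /hclass_eq[[a b']] /= /(congr1 fst) /=; rewrite subr0 => e.
apply/hclass_eq0 => /=; rewrite e.
exists (transport_deg A (n + 1 - 1) (n - 1 + 1) (- a)).
by rewrite diff_transport 1?addrAC // linearN.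
Qed.

Lemma exact_connecting n :
  exact_at (connecting n) (homology_map u (n - 1)).
Proof.
have en : n = n - 1 + 1 by rewrite subrK.
move=> c; have [z ->] := hclass_surj c; rewrite homology_mapE; split.
  move=> /hclass_eq0 /= [b eb].
  have cw : @is_cycle R (cone u) n
      (\val z, - transport_deg B (n - 1 + 1) n b).
    apply/cone_cycleP; split; first exact: cycleP.
    by rewrite /= linearN /= diff_transport // eb.
  exists (hclass _ n (mkcycle cw)).
  rewrite (connectingE (z := mkcycle cw) (cycleP z)).
  by congr (hclass _ _ _); apply: val_inj.
move=> [w]; have [{}w ->] := hclass_surj w.
have [ca eb] := (cone_cycleP (\val w)).1 (cycleP w).
rewrite (connectingE ca) => /hclass_eq[a' /= ea].
apply/hclass_eq0 => /=.
exists (u (n - 1 + 1) a' - transport_deg B n (n - 1 + 1) (\val w).2).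
rewrite linearB /= diff_transport // eb opprK -chfun_diff -ea linearB /=.
by rewrite subrK.
Qed.

End LongExactSequence.

Arguments exact_cone_in {R A B} u n.
Arguments exact_cone_out {R A B} u n.
Arguments exact_connecting {R A B} u n.

Section Thick.
Variable R : comPzRingType.

Lemma fgproj_homology_zero_diff (X : complex R) :
    (forall i j x, diff X i j x = 0) -> (forall i, fgproj (X i)) ->
  fgproj_homology X.
Proof.
move=> d0 pX n.
have c (x : X n) : is_cycle x by apply: d0.
pose g (x : X n) := mkcycle (c x).
have lg : linear g by move=> a x y; apply: val_inj.
pose f (z : cycle X n) : X n := \val z.
have lf : linear f by [].
have [|h hE] := homology_factor (f := linear_map lf).
  by move=> z [y ey]; rewrite /= /f ey d0.
apply: (fgproj_retract (i := h) (r := hclass X n \o linear_map lg)) (pX n) => x.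
have [z ->] := hclass_surj x; rewrite hE /=.
by congr (hclass _ _ _); apply: val_inj.
Qed.

Lemma fgproj_sphere i : fgproj (sphere R i).
Proof.
rewrite /= /sphere_obj; case: eqP => _; first exact: fgproj_ring.
exact: fgproj_free.
Qed.

Lemma fgproj_homology_triangle (A B : complex R) (u : chmap A B) :
    von_neumann_regular R ->
  [/\ fgproj_homology A -> fgproj_homology B -> fgproj_homology (cone u),
      fgproj_homology B -> fgproj_homology (cone u) -> fgproj_homology A
    & fgproj_homology A -> fgproj_homology (cone u) -> fgproj_homology B].
Proof.
move=> regR; split=> p q n.
- exact: (fgproj_five regR (exact_cone_in u n) (exact_cone_out u n)
            (exact_connecting u n) (p n) (q n) (p (n - 1)) (q (n - 1))).
- rewrite -[n](addrK 1); move: (n + 1) => {}n.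
  exact: (fgproj_five regR (exact_cone_out u n) (exact_connecting u n)
            (exact_cone_in u (n - 1)) (p n) (q n) (p (n - 1)) (q (n - 1))).
- rewrite -[n](addrK 1); move: (n + 1) => {}n.
  exact: (fgproj_five regR (exact_connecting u n) (exact_cone_in u (n - 1))
            (exact_cone_out u (n - 1))
            (q n) (p (n - 1)) (q (n - 1)) (p (n - 1 - 1))).
Qed.

(** Each of the three terms of a triangle sits in the middle of five consecutive
    terms of the long exact sequence, the other four of which belong to the two
    remaining terms of the triangle. *)
Lemma thick_fgproj_homology :
  von_neumann_regular R -> is_thick (@fgproj_homology R).
Proof.
move=> regR; split.
- by move=> X; apply: fgproj_homology_shift.
- by move=> X; apply: fgproj_homology_shift.
- exact: fgproj_homology_retract.
move=> X Y Z f g h [A [B [u [a [b [c [[isoa isob isoc] _]]]]]]].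
have [pAX pXA] := diso_retract isoa.
have [pBY pYB] := diso_retract isob.
have [pCZ pZC] := diso_retract isoc.
have [tC tA tB] := fgproj_homology_triangle u regR.
split=> p q.
- apply: fgproj_homology_retract pZC (tC _ _).
    exact: fgproj_homology_retract pAX p.
  exact: fgproj_homology_retract pBY q.
- apply: fgproj_homology_retract pXA (tA _ _).
    exact: fgproj_homology_retract pBY p.
  exact: fgproj_homology_retract pCZ q.
- apply: fgproj_homology_retract pYB (tB _ _).
    exact: fgproj_homology_retract pAX p.
  exact: fgproj_homology_retract pCZ q.
Qed.

Lemma thick_fgproj (X : complex R) :
  von_neumann_regular R -> thick_closure (sphere R) X -> fgproj_homology X.
Proof.
move=> regR; move/(_ _ (thick_fgproj_homology regR)); apply.
by apply: fgproj_homology_zero_diff => //; apply: fgproj_sphere.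
Qed.

End Thick.

(** * K-projective complexes *)

Section Homotopy.
Variable R : comPzRingType.
Implicit Types X Y Z P C : complex R.

(** The indices m and l are kept free, with equations, so that the formula can be
    instantiated at degrees that are equal to n + 1 and n - 1 without being so
    syntactically. *)
Definition homotopy X Y (f g : chmap X Y) (h : forall i j, {linear X i -> Y j}) :=
  forall n m l, m = n + 1 -> l = n - 1 -> forall x,
    f n x - g n x = diff Y m n (h n m x) + h l n (diff X n l x).

Lemma homotopicP X Y (f g : chmap X Y) :
  homotopic f g <-> exists h, homotopy f g h.
Proof.
split=> -[h hE]; exists h; first by move=> n m l -> ->.
by move=> n x; apply: hE.
Qed.

Lemma homotopic_eq X Y (f g : chmap X Y) :
  (forall n x, f n x = g n x) -> homotopic f g.
Proof.
move=> fg; exists (fun i j => \0) => n x.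
by rewrite fg subrr /= linear0 addr0.
Qed.

Lemma homotopic_refl X Y (f : chmap X Y) : homotopic f f.
Proof. exact: homotopic_eq. Qed.

Lemma homotopic_sym X Y (f g : chmap X Y) : homotopic f g -> homotopic g f.
Proof.
move=> [h hE]; exists (fun i j => -1 \*: h i j) => n x.
by rewrite /= linearZ /= -scalerDr -hE scaleN1r opprB.
Qed.

Lemma homotopic_trans X Y (f g k : chmap X Y) :
  homotopic f g -> homotopic g k -> homotopic f k.
Proof.
move=> [h hE] [h' hE']; exists (fun i j => h i j \+ h' i j) => n x.
by rewrite /= linearD addrACA -hE -hE' addrA subrK.
Qed.

Lemma homotopic_compr X Y Z (f g : chmap X Y) (k : chmap Y Z) :
  homotopic f g -> homotopic (chcomp k f) (chcomp k g).
Proof.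
move=> [h hE]; exists (fun i j => k j \o h i j) => n x.
by rewrite /= -linearB hE linearD /= chfun_diff.
Qed.

Lemma homotopic_compl X Y Z (f g : chmap Y Z) (k : chmap X Y) :
  homotopic f g -> homotopic (chcomp f k) (chcomp g k).
Proof.
move=> [h hE]; exists (fun i j => h i j \o k i) => n x.
by rewrite /= hE chfun_diff.
Qed.

Definition acyclic C : Prop := forall n (x : C n), is_cycle x -> is_boundary x.

(** By the long exact sequence, as s is invertible on homology. *)
Lemma acyclic_cone X Y (s : chmap X Y) : quasi_iso s -> acyclic (cone s).
Proof.
move=> qs n x cx; rewrite -[x]/(\val (mkcycle cx)); apply/hclass_eq0.
set c := hclass _ _ _.
have /exact_cone_out[b ->] : connecting s n c = 0.
  apply: (can_inj (homology_mapK qs (n := n - 1))); rewrite linear0.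
  by apply/exact_connecting; exists c.
apply/exact_cone_in; exists (homology_inv qs n b).
by rewrite homology_invK.
Qed.

Lemma acyclic_shift k C : acyclic C -> acyclic (shift k C).
Proof. by move=> aC n x /shift_cycle cx; apply/shift_boundary/aC. Qed.

Definition kproj P : Prop :=
  forall C, acyclic C -> forall f : chmap P C, homotopic f (chzero P C).

(** K-projectivity for maps of degree 1.  A family f that anticommutes with the
    differentials is a chain map from P to the desuspension of C, because C (i + 1)
    is convertible to C (i - -1). *)
Lemma kproj_degree1 P C (f : forall i, {linear P i -> C (i + 1)}) :
    kproj P -> acyclic C ->
    (forall j x, f j (diff P (j + 1) j x) =
                 - diff C (j + 1 + 1) (j + 1) (f (j + 1) x)) ->
  exists h : forall i j, {linear P i -> C (j + 1)},
    forall n m l, m = n + 1 -> l = n - 1 -> forall x,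
    f n x = h l n (diff P n l x) - diff C (m + 1) (n + 1) (h n m x).
Proof.
move=> pP aC fd.
have fd' i j x : f j (diff P i j x) = diff (shift (-1) C) i j (f i x).
  rewrite /= /shift_diff /= expr1 scaleN1r.
  have [e|ij] := eqVneq i (j + 1); first by subst i; exact: fd.
  rewrite !diff_shape ?linear0 ?oppr0 //.
  by apply: contra ij; rewrite -[_ == _]/(i + 1 == j + 1 + 1) (inj_eq (addIr _)).
have /homotopicP[h hE] :=
  pP _ (acyclic_shift (k := -1) aC) (@ChMap R P (shift (-1) C) f fd').
exists h => n m l em el x; have := hE n m l em el x.
by rewrite /= subr0 /shift_diff /= expr1 scaleN1r => ->; apply: addrC.
Qed.

(** A null-homotopy of P -> Y -> cone s has a component P -> X, which is the lift,
    and a component of degree 1 to Y, which is the homotopy to f. *)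
Lemma kproj_lift P X Y (s : chmap X Y) (f : chmap P Y) :
  kproj P -> quasi_iso s -> exists g : chmap P X, homotopic (chcomp s g) f.
Proof.
move=> pP qs.
have /homotopicP[h hE] := pP _ (acyclic_cone qs) (chcomp (cone_in s) f).
pose g i : {linear P i -> X i} :=
  transport_deg X (i + 1 - 1) i \o (fst \o h i (i + 1)).
have gd i j x : g j (diff P i j x) = diff X i j (g i x).
  have [e|ij] := eqVneq i (j + 1); last by rewrite !diff_shape ?linear0.
  subst i.
  have /(congr1 fst)/= := hE (j + 1) _ j erefl (esym (addrK _ _)) x.
  rewrite subr0 => /esym/eqP; rewrite addr_eq0 eqr_opp => /eqP e.
  by rewrite /g /= -e transport_diff ?addrK // diff_transport ?addrK.
exists (ChMap gd); apply: homotopic_sym.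
exists (fun i j => snd \o h i j) => n x.
have /(congr1 snd)/= := hE n _ _ erefl erefl x.
rewrite subr0 => ->; rewrite /g /= chmap_transport.
by rewrite addrAC addrK.
Qed.

(** A null-homotopy k of s f makes (f, -k) a degree 1 map from P to the acyclic
    complex cone s; the first component of its null-homotopy is one of f. *)
Lemma kproj_null P X Y (s : chmap X Y) (f : chmap P X) :
    kproj P -> quasi_iso s -> homotopic (chcomp s f) (chzero P Y) ->
  homotopic f (chzero P X).
Proof.
move=> pP qs /homotopicP[k kE].
pose g i (x : P i) : cone s (i + 1) :=
  (transport_deg X i (i + 1 - 1) (f i x), - k i (i + 1) x).
have lg i : linear (@g i).
  move=> a x y; rewrite /g; apply: (congr2 pair); first by rewrite !linearP.
  by rewrite linearP opprD -scalerN.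
have [|h hE] :=
  kproj_degree1 (f := fun i => linear_map (lg i)) pP (acyclic_cone qs).
  move=> j x; rewrite /= /g /= /cone_diff /=.
  rewrite chmap_transport transport_trans ?addrK // transport_deg_id.
  apply: (congr2 pair) => /=.
    by rewrite opprK diff_transport ?addrK // chfun_diff.
  have /= := kE (j + 1) _ j erefl (esym (addrK _ _)) x.
  by rewrite subr0 transport_deg_id => ->; rewrite linearN /= addrA addNr add0r.
exists (fun i j => transport_deg X (j + 1 - 1) j \o (fst \o h i j)) => n x.
have /(congr1 (fun z => transport_deg X (n + 1 - 1) n z.1)) :=
  hE n _ _ erefl erefl x.
rewrite /= /g /= transport_deg_eq ?addrK // opprK subr0 => ->.
by rewrite linearD /= addrC transport_diff ?addrK // diff_transport ?addrK.
Qed.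

(** Choose a null-homotopy k of the restriction of f to B.  Then f (a, 0) - k (u a)
    is a degree 1 map from A to C; with a null-homotopy h of it, k - h is a
    null-homotopy of f. *)
Lemma kproj_cone A B (u : chmap A B) : kproj A -> kproj B -> kproj (cone u).
Proof.
move=> pA pB C aC f.
have /homotopicP[k kE] := pB _ aC (chcomp f (cone_in u)).
pose inl i (a : A i) : cone u (i + 1) := (transport_deg A i (i + 1 - 1) a, 0).
have linl i : linear (@inl i).
  move=> r x y; rewrite /inl; apply: (congr2 pair); first by rewrite linearP.
  by rewrite /= scaler0 addr0.
pose g i : {linear A i -> C (i + 1)} :=
  (f (i + 1) \o linear_map (@linl i)) \- (k i (i + 1) \o u i).
have [|h hE] := kproj_degree1 (f := g) pA aC.
  move=> j x; rewrite /g /=.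
  have /= := kE (j + 1) _ j erefl (esym (addrK _ _)) (u _ x).
  rewrite subr0 => e.
  rewrite linearB /= -chfun_diff.
  have -> : diff (cone u) (j + 1 + 1) (j + 1) (inl (j + 1) x) =
            - inl j (diff A (j + 1) j x) + cone_in u (j + 1) (u (j + 1) x).
    rewrite /= /cone_diff /inl /= linear0 add0r.
    rewrite diff_transport ?addrK // transport_diff ?addrK //.
    rewrite chmap_transport transport_deg_eq ?addrK //.
    by apply: (congr2 pair) => /=; rewrite ?addr0 // oppr0 add0r.
  rewrite (linearD (f _)) (linearN (f _)) /= e -chfun_diff addrA.
  by rewrite [_ + _ + _ - _]addrAC [X in - (X + _)]addrK opprD opprK.
pose H i j (z : cone u i) : C j :=
  k i j z.2 - transport_deg C (j - 1 + 1) j (h (i - 1) (j - 1) z.1).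
have lH i j : linear (@H i j).
  move=> r x y; rewrite /H (linearP (k i j)) (linearP (h _ _)).
  by rewrite (linearP (transport_deg _ _ _)) /= scalerBr opprD addrACA.
exists (fun i j => linear_map (lH i j)) => n [a b].
have en : n - 1 + 1 = n by rewrite subrK.
have en' : n + 1 - 1 = n - 1 + 1 by rewrite addrAC.
have /= fb := kE n _ _ erefl erefl b; rewrite subr0 in fb.
have /(congr1 (transport_deg C (n - 1 + 1) n)) fa :=
  hE (n - 1) (n + 1 - 1) _ en' erefl a.
rewrite linearB /= (linearB (transport_deg _ _ _)) /= in fa.
rewrite (transport_deg_family
  (fun m => f m (transport_deg A (n - 1) (m - 1) a, 0)) en) in fa.
rewrite (transport_deg_family (fun m => k (n - 1) m (u (n - 1) a)) en) in fa.
rewrite transport_deg_id transport_diff // in fa.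
have -> : (a, b) = cone_in_fun u b + (a, 0) :> cone u n.
  by apply: (congr2 pair) => /=; rewrite ?add0r ?addr0.
rewrite subr0 linearD fb.
move/eqP: fa; rewrite subr_eq => /eqP ->.
rewrite /H /= /cone_diff /= !add0r !addr0 transport_deg_id.
rewrite linearB /= (linearD (k _ _)) /= !linearN /= opprK.
rewrite diff_transport ?subrK ?addrK //.
by rewrite [LHS](AC (2 * (2 * 1)) ((1 * 4) * (2 * 5 * 3))).
Qed.

(** When the source has zero differential, a null-homotopy amounts to lifts of the
    components of f through the boundary maps of Y. *)
Lemma null_zero_diff P Y (f : chmap P Y) :
    (forall i j x, diff P i j x = 0) -> (forall i, fgproj (P i)) ->
    (forall n x, is_boundary (f n x)) ->
  homotopic f (chzero P Y).
Proof.
move=> d0 pP bf.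
have hE n : exists h : {linear P n -> Y (n + 1)},
    forall x, diff Y (n + 1) n (h x) = f n x.
  by apply: fgproj_lift => // x; have [y ->] := bf n x; exists y.
exists (fun i j => transport_deg Y (i + 1) j \o projT1 (cid (hE i))) => n x.
rewrite /= d0 !linear0 transport_deg_id !addr0.
by rewrite (projT2 (cid (hE n))).
Qed.

Lemma kproj_zero_diff P :
    (forall i j x, diff P i j x = 0) -> (forall i, fgproj (P i)) -> kproj P.
Proof.
move=> d0 pP C aC f; apply: null_zero_diff => // n x.
by apply: aC; apply: chmap_cycle; apply: d0.
Qed.

End Homotopy.

(** * Morphisms out of a K-projective complex *)

Section KProjectiveHoms.
Variable R : comPzRingType.
Implicit Types X Y Z P C : complex R.

Lemma chsub_diff X Y (f g : chmap X Y) i j x :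
  (f j \- g j) (diff X i j x) = diff Y i j ((f i \- g i) x).
Proof. by rewrite /= !chfun_diff linearB. Qed.

Definition chsub X Y (f g : chmap X Y) : chmap X Y :=
  @ChMap R X Y (fun i => f i \- g i) (chsub_diff f g).

Lemma kproj_inj P X Y (s : chmap X Y) (f g : chmap P X) :
    kproj P -> quasi_iso s -> homotopic (chcomp s f) (chcomp s g) ->
  homotopic f g.
Proof.
move=> pP qs [h hE].
have [|k kE] := kproj_null (f := chsub f g) pP qs.
  by exists h => n x; rewrite -hE /= linearB subr0.
by exists k => n x; rewrite -kE /= subr0.
Qed.

(** The action of a morphism X -> Y of D(R) on homotopy classes of chain maps from
    P.  It is a relation, as an inverted quasi-isomorphism acts by lifting, and
    lifts are unique only up to homotopy. *)
Fixpoint acts P X Y (f : dhom X Y) : chmap P X -> chmap P Y -> Prop :=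
  match f in dhom X' Y' return chmap P X' -> chmap P Y' -> Prop with
  | dmap _ _ f => fun a b => homotopic (chcomp f a) b
  | dinv _ _ s _ => fun a b => homotopic (chcomp s b) a
  | dcomp _ _ _ g f => fun a c => exists b, acts f a b /\ acts g b c
  end.

Lemma acts_homotopic P X Y (f : dhom X Y) (a a' : chmap P X) (b b' : chmap P Y) :
  homotopic a a' -> homotopic b b' -> acts f a b -> acts f a' b'.
Proof.
elim: f a a' b b' => {X Y} [X Y f|X Y s qs|X Y Z g IHg f IHf] a a' b b' /=
  haa hbb.
- move=> hab; apply: homotopic_trans hbb; apply: homotopic_trans hab.
  exact/homotopic_compr/homotopic_sym.
- move=> hab; apply: homotopic_trans haa; apply: homotopic_trans hab.
  exact/homotopic_compr/homotopic_sym.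
- move=> [c [fac gcb]]; exists c; split.
    exact: IHf haa (homotopic_refl c) fac.
  exact: IHg (homotopic_refl c) hbb gcb.
Qed.

Lemma acts_total P X Y (f : dhom X Y) (a : chmap P X) :
  kproj P -> exists b, acts f a b.
Proof.
move=> pP; elim: f a => {X Y} [X Y f|X Y s qs|X Y Z g IHg f IHf] a /=.
- by exists (chcomp f a); apply: homotopic_refl.
- exact: kproj_lift.
- have [b fab] := IHf a; have [c gbc] := IHg b.
  by exists c, b.
Qed.

Lemma acts_unique P X Y (f : dhom X Y) (a : chmap P X) (b b' : chmap P Y) :
  kproj P -> acts f a b -> acts f a b' -> homotopic b b'.
Proof.
move=> pP; elim: f a b b' => {X Y} [X Y f|X Y s qs|X Y Z g IHg f IHf] a b b' /=.
- by move=> /homotopic_sym; apply: homotopic_trans.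
- move=> hb /homotopic_sym hb'; apply: (kproj_inj pP qs).
  exact: homotopic_trans hb hb'.
- move=> [c [fac gcb]] [c' [fac' gcb']]; apply: IHg gcb _.
  apply: acts_homotopic (homotopic_refl b') gcb'.
  exact: IHf fac' fac.
Qed.

(** That s and its formal inverse cancel uses both halves of K-projectivity:
    lifts through s exist, and they are unique up to homotopy. *)
Lemma acts_deq P X Y (f g : dhom X Y) :
  kproj P -> deq f g -> forall (a : chmap P X) b, acts f a b <-> acts g a b.
Proof.
move=> pP; elim=> {X Y f g}.
- by [].
- by move=> X Y f g _ IH a b; rewrite IH.
- by move=> X Y f g h _ IH1 _ IH2 a b; rewrite IH1 IH2.
- move=> X Y Z g g' f f' _ IHg _ IHf a b /=.
  by split=> -[c [/IHf fac /IHg gcb]]; exists c.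
- move=> X Y Z W h g f a b /=; split.
    by move=> [c [[d [fad gdc]] hcb]]; exists d; split=> //; exists c.
  by move=> [d [fad [c [gdc hcb]]]]; exists c; split=> //; exists d.
- move=> X Y f a b /=; split=> [[c [fac cb]]|fab]; last first.
    by exists b; split=> //; apply: homotopic_eq.
  apply: acts_homotopic (homotopic_refl a) _ fac.
  by apply: homotopic_trans cb; apply: homotopic_eq.
- move=> X Y f a b /=; split=> [[c [ac fcb]]|fab]; last first.
    by exists a; split=> //; apply: homotopic_eq.
  apply: acts_homotopic (homotopic_refl b) fcb.
  by apply: homotopic_sym; apply: homotopic_trans ac; apply: homotopic_eq.
- move=> X Y Z g f a b /=; split=> [gfab|[c [fac gcb]]].
    exists (chcomp f a); split; first exact: homotopic_refl.
    by apply: homotopic_trans gfab; apply: homotopic_eq.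
  apply: homotopic_trans gcb; apply: homotopic_trans (homotopic_compr g fac).
  exact: homotopic_eq.
- move=> X Y f g fg a b /=; have ha := homotopic_compl a fg; split.
    by apply: homotopic_trans; apply: homotopic_sym.
  exact: homotopic_trans.
- move=> X Y s qs a b /=; split=> [[c [sca scb]]|ab].
    apply: homotopic_trans scb; apply: homotopic_sym.
    by apply: homotopic_trans sca _; apply: homotopic_eq.
  have [c sca] := kproj_lift a pP qs; exists c; split=> //.
  apply: homotopic_trans sca _; apply: homotopic_trans ab.
  exact: homotopic_eq.
- move=> X Y s qs a b /=; split=> [[c [sac sbc]]|ab].
    apply: homotopic_trans (_ : homotopic (chcomp (chid X) a) a) _.
      exact: homotopic_eq.
    apply: (kproj_inj pP qs); apply: homotopic_trans sac _.
    exact: homotopic_sym.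
  exists (chcomp s a); split; first exact: homotopic_refl.
  apply: homotopic_compr; apply: homotopic_sym; apply: homotopic_trans ab.
  exact: homotopic_eq.
Qed.

Lemma acts_dcomp P X Y (f : dhom X Y) (a : chmap P X) b :
  acts f a b -> deq (dcomp f (dmap a)) (dmap b).
Proof.
elim: f a b => {X Y} [X Y f|X Y s qs|X Y Z g IHg f IHf] a b /=.
- move=> fab; apply: deq_trans (deq_homotopic fab).
  exact/deq_sym/deq_map_comp.
- move=> sba.
  have e := deq_trans (deq_sym (deq_map_comp s b)) (deq_homotopic sba).
  apply: deq_trans (deq_comp (deq_refl _) (deq_sym e)) _.
  apply: deq_trans (deq_assoc _ _ _) _.
  apply: deq_trans (deq_comp (deq_invl qs) (deq_refl _)) _.
  exact: deq_idl.
- move=> [c [/IHf fac /IHg gcb]].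
  apply: deq_trans (deq_sym (deq_assoc _ _ _)) _.
  exact: deq_trans (deq_comp (deq_refl _) fac) gcb.
Qed.

Lemma kproj_full P X (f : dhom P X) :
  kproj P -> exists a : chmap P X, deq f (dmap a).
Proof.
move=> pP; have [a fa] := acts_total f (chid P) pP; exists a.
exact: deq_trans (deq_sym (deq_idr f)) (acts_dcomp fa).
Qed.

Lemma kproj_faithful P X (a b : chmap P X) :
  kproj P -> deq (dmap a) (dmap b) -> homotopic a b.
Proof.
move=> pP ab.
have aa : acts (dmap a) (chid P) a by apply: homotopic_eq.
have bb : acts (dmap b) (chid P) b by apply: homotopic_eq.
by apply: acts_unique (pP) _ bb; apply/(acts_deq pP ab).
Qed.

Lemma deq_map_eq X Y (f g : chmap X Y) :
  (forall n x, f n x = g n x) -> deq (dmap f) (dmap g).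
Proof. by move=> fg; apply/deq_homotopic/homotopic_eq. Qed.

(** Zero precomposed with a formal inverse of s: write zero as zero after s. *)
Lemma dcomp_dzerol X Y Z (f : dhom X Y) : deq (dcomp (dzero Y Z) f) (dzero X Z).
Proof.
elim: f Z => {X Y} [X Y f|X Y s qs|X Y W g IHg f IHf] Z.
- apply: deq_trans (deq_sym (deq_map_comp _ _)) _.
  exact: deq_map_eq.
- have e : deq (dcomp (dzero Y Z) (dmap s)) (dzero X Z).
    apply: deq_trans (deq_sym (deq_map_comp _ _)) _.
    exact: deq_map_eq.
  apply: deq_trans (deq_comp (deq_sym e) (deq_refl _)) _.
  apply: deq_trans (deq_sym (deq_assoc _ _ _)) _.
  apply: deq_trans (deq_comp (deq_refl _) (deq_invr qs)) _.
  exact: deq_idr.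
- apply: deq_trans (deq_assoc _ _ _) _.
  exact: deq_trans (deq_comp (IHg Z) (deq_refl _)) (IHf Z).
Qed.

Lemma shift_sphere_diff k i j x : diff (shift k (sphere R)) i j x = 0.
Proof. by rewrite /= /shift_diff /= scaler0. Qed.

Lemma kproj_shift_sphere k : kproj (shift k (sphere R)).
Proof.
apply: kproj_zero_diff => [i j x|i]; first exact: shift_sphere_diff.
exact: fgproj_sphere.
Qed.

Lemma kproj_sphere : kproj (sphere R).
Proof. by apply: kproj_zero_diff => // i; apply: fgproj_sphere. Qed.

(** Detects pi_* f = 0 on elements: a morphism from a sphere is represented by a
    chain map, and it picks out a homology class. *)
Lemma pi_zero_boundary X Y (f : chmap X Y) :
    (forall n (x : X n), is_cycle x -> is_boundary (f n x)) ->
  forall i, pi_zero (dmap f) i.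
Proof.
move=> bf i a; have [b ab] := kproj_full a (@kproj_shift_sphere i).
apply: deq_trans (deq_comp (deq_refl _) ab) _.
apply: deq_trans (deq_sym (deq_map_comp _ _)) _.
apply: deq_homotopic; apply: null_zero_diff => [j k x|j|n x].
- exact: shift_sphere_diff.
- exact: fgproj_sphere.
- by apply: bf; apply: chmap_cycle; apply: shift_sphere_diff.
Qed.

(** * The generating hypothesis over a regular ring *)

(** The universal property of the sphere: elements of degree n are maps from
    Sigma^n S. *)
Lemma sphere_point X n (x : X n) : (forall i j y, diff X i j y = 0) ->
  exists (a : chmap (shift n (sphere R)) X) e, a n e = x.
Proof.
move=> d0.
have [a [e ae]] : exists (a : {linear sphere R (n - n) -> X n}) e, a e = x.
  rewrite subrr; pose a (r : sphere R 0) : X n := (r : R^o) *: x.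
  have la : linear a by move=> r s t; rewrite /a scalerDl scalerA.
  by exists (linear_map la), (1 : R^o); rewrite /= /a scale1r.
pose f i : {linear shift n (sphere R) i -> X i} :=
  transport_deg X n i \o a \o transport_deg (shift n (sphere R)) i n.
have fd i j y : f j (diff (shift n (sphere R)) i j y) = diff X i j (f i y).
  by rewrite shift_sphere_diff linear0 d0.
by exists (ChMap fd), e; rewrite /= !transport_deg_id.
Qed.

(** Projectivity of H_n X gives a section of Z_n X -> H_n X, which serves as the
    degree n component of a map from H_* X to X. *)
Lemma homology_model X : fgproj_homology X ->
  exists (H : complex R) (s : chmap H X),
    [/\ quasi_iso s, forall i, fgproj (H i) & forall i j x, diff H i j x = 0].
Proof.
move=> pX.
pose H : complex R := @Complex R (fun n => (homology X n : lmodType R))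
  (fun i j => \0) (fun i j x _ => erefl) (fun i j k x => erefl).
have sE n : exists s : {linear homology X n -> cycle X n},
    forall c, hclass X n (s c) = c.
  apply: (fgproj_lift (g := hclass X n) (f := idfun) (pX n)) => c /=.
  by have [z ->] := hclass_surj c; exists z.
pose val_cycle n (z : cycle X n) : X n := \val z.
have lv n : linear (@val_cycle n) by [].
pose s n : {linear H n -> X n} := linear_map (lv n) \o projT1 (cid (sE n)).
have sP n (c : H n) : exists2 z, s n c = \val z & hclass X n z = c.
  by exists (projT1 (cid (sE n)) c) => //; rewrite (projT2 (cid (sE n))).
have sd i j x : s j (diff H i j x) = diff X i j (s i x).
  rewrite linear0; have [z -> _] := sP i x.
  have [e|ij] := eqVneq i (j + 1); last by rewrite diff_shape.
  have ej : j = i - 1 by rewrite e addrK.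
  by subst j; rewrite (cycleP z).
exists H, (ChMap sd); split=> // n; split.
  move=> c _ bc; have [z e <-] := sP n c; exists 0; rewrite linear0.
  by apply/hclass_eq0; rewrite -e.
move=> y cy; exists (hclass X n (mkcycle cy)) => //.
have [z e /esym/hclass_eq] := sP n (hclass X n (mkcycle cy)).
by rewrite -e.
Qed.

(** Replace X by its homology; the composite g is a chain map, and each element x
    of the source is hit by a sphere, so pi_* f = 0 makes g x a boundary. *)
Lemma von_neumann_regular_generating_hypothesis :
  von_neumann_regular R -> generating_hypothesis R.
Proof.
move=> regR X Y f tX _ f0.
have [H [s [qs pH d0]]] := homology_model (thick_fgproj regR tX).
have kH := kproj_zero_diff d0 pH.
have [g fg] := kproj_full (dcomp f (dmap s)) kH.
have g0 : homotopic g (chzero H Y).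
  apply: null_zero_diff => // n x.
  have [a [e <-]] := sphere_point x d0.
  have /kproj_faithful[|h hE] : deq (dmap (chcomp g a)) (dzero _ _).
  - apply: deq_trans (deq_map_comp _ _) _.
    apply: deq_trans (deq_comp (deq_sym fg) (deq_refl _)) _.
    apply: deq_trans (deq_sym (deq_assoc _ _ _)) _.
    exact: f0.
  - exact: kproj_shift_sphere.
  exists (h n (n + 1) e); have := hE n e.
  by rewrite shift_sphere_diff /= !linear0 !addr0.
apply: deq_trans (deq_sym (deq_idr f)) _.
apply: deq_trans (deq_comp (deq_refl _) (deq_sym (deq_invr qs))) _.
apply: deq_trans (deq_assoc _ _ _) _.
apply: deq_trans (deq_comp (deq_trans fg (deq_homotopic g0)) (deq_refl _)) _.
exact: dcomp_dzerol.
Qed.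

End KProjectiveHoms.

(** * From the generating hypothesis to regularity *)

Section ThickClosure.
Variable R : comPzRingType.
Implicit Types X Y S : complex R.

Lemma diso_id X : diso (did X).
Proof. by exists (did X); split; apply: deq_idl. Qed.

Lemma exact_triangle_cone X Y (u : chmap X Y) :
  exact_triangle (dmap u) (dmap (cone_in u)) (dmap (cone_out u)).
Proof.
exists X, Y, u, (did X), (did Y), (did (cone u)).
split; first by split; apply: diso_id.
split.
- exact: deq_trans (deq_idl _) (deq_sym (deq_idr _)).
- exact: deq_trans (deq_idl _) (deq_sym (deq_idr _)).
apply: deq_trans _ (deq_sym (deq_idr _)).
apply: deq_trans (deq_sym (deq_map_comp _ _)) _.
exact: deq_map_eq.
Qed.

Lemma thick_closure_self S : thick_closure S S.
Proof. by []. Qed.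

Lemma thick_closure_suspension S X :
  thick_closure S X -> thick_closure S (shift 1 X).
Proof. by move=> tX P tP PS; apply: (thick_suspension tP); apply: tX. Qed.

Lemma thick_closure_cone S X Y (u : chmap X Y) :
  thick_closure S X -> thick_closure S Y -> thick_closure S (cone u).
Proof.
move=> tX tY P tP PS.
have [+ _ _] := thick_triangle tP (exact_triangle_cone u).
by apply; [apply: tX | apply: tY].
Qed.

End ThickClosure.

Section Reduced.
Variable R : comPzRingType.

Lemma cone_diffE (X Y : complex R) (u : chmap X Y) i j (z : cone u i) :
  diff (cone u) i j z =
  (- diff X (i - 1) (j - 1) z.1,
   diff Y i j z.2 + transport_deg Y (i - 1) j (u (i - 1) z.1)).
Proof. by []. Qed.

Lemma chscale_diff (x : R) (X : complex R) i j (y : X i) :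
  (x \*: idfun) (diff X i j y) = diff X i j ((x \*: idfun) y).
Proof. by rewrite /= linearZ. Qed.

Definition chscale (x : R) (X : complex R) : chmap X X :=
  @ChMap R X X (fun i => x \*: idfun) (@chscale_diff x X).

Local Notation S := (sphere R).

Section SquareZero.
Variables (x : R) (xx : x * x = 0).

(** The map Sigma S -> cone x that hits the top cell with coefficient x; its cone
    is the complex R -x-> R -x-> R in degrees 2, 1, 0. *)
Definition attach_fun i (a : shift 1 S i) : cone (chscale x S) i := (x *: a, 0).

Lemma attach_linear i : linear (@attach_fun i).
Proof.
move=> r a b; rewrite /attach_fun; apply: (congr2 pair) => /=.
  by rewrite scalerDr !scalerA mulrC.
by rewrite scaler0 addr0.
Qed.

HB.instance Definition _ i :=
  GRing.isLinear.Build R _ _ _ (@attach_fun i) (@attach_linear i).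

Lemma attach_diff i j a :
  attach_fun (diff (shift 1 S) i j a) =
  diff (cone (chscale x S)) i j (attach_fun a).
Proof.
rewrite shift_sphere_diff linear0 /= /cone_diff /= oppr0 add0r.
by rewrite scalerA xx scale0r linear0.
Qed.

Definition attach : chmap (shift 1 S) (cone (chscale x S)) := ChMap attach_diff.

(** For a cycle (a, (b, c)) both x a and x b vanish, and x c is the boundary of c
    placed on the cell one degree higher. *)
Lemma cone_attach_homology n (z : cone attach n) :
  is_cycle z -> is_boundary (chscale x (cone attach) n z).
Proof.
case: z => a [b c] /cone_cycleP[_] /= [].
rewrite /= !oppr0 add0r transport_deg_id => xa0 xb0.
have xb : x *: b = 0 by [].
have xa : x *: a = 0 by apply/eqP; rewrite -oppr_eq0 -xa0.
exists (0, (transport_deg S n (n + 1 - 1) c, 0)).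
have -> : x *: (a, (b, c)) = (x *: a, (x *: b, x *: c)) :> cone attach n by [].
rewrite xa xb !cone_diffE /= linear0 oppr0; congr (_, _).
rewrite [attach_fun _](linear0 (attach_fun (i := _))).
rewrite (linear0 (transport_deg _ _ _)) addr0 oppr0 add0r.
by rewrite -linearZ /= transport_deg_eq ?addrK.
Qed.

(** Evaluating a null-homotopy on the generators e0, e1, e2 of degrees 0, 1, 2
    expresses x in three ways; the expression in degree 1 is the sum of the other
    two, so x = x + x. *)
Lemma cone_attach_null :
  homotopic (chscale x (cone attach)) (chzero (cone attach) (cone attach)) ->
  x = 0.
Proof.
move=> /homotopicP[h hE].
(* The degrees are numerals, so S 0, S (1 - 1) and S (2 - 1 - 1) all compute to
   R and no transport remains. *)
pose one : S 0 := (1 : R^o).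
pose e0 : cone attach 0 := (0, (0, one)).
pose e1 : cone attach 1 := (0, (one, 0)).
pose e2 : cone attach 2 := (one, (0, 0)).
have d0 : diff (cone attach) 0 (-1) e0 = 0.
  by rewrite !cone_diffE /= !(linear0, oppr0, addr0, add0r).
have d1 : diff (cone attach) 1 0 e1 = x *: e0.
  have -> : x *: e0 = (x *: 0, (x *: 0, x *: one)) :> cone attach 0 by [].
  rewrite !cone_diffE shift_sphere_diff /= !(transport_deg_id _ (i := 0)).
  by rewrite /attach_fun !scaler0 !oppr0 !add0r ?addr0.
have d2 : diff (cone attach) 2 1 e2 = x *: e1.
  have -> : x *: e1 = (x *: 0, (x *: one, x *: 0)) :> cone attach 1 by [].
  rewrite !cone_diffE shift_sphere_diff /= !(transport_deg_id _ (i := 1)).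
  rewrite /attach_fun !scaler0 !oppr0 !add0r; congr (_, _); exact: add0r.
have p1 z : (diff (cone attach) 1 0 z).2.2 = x *: (z.2.1 : S 0).
  rewrite !cone_diffE /= !(transport_deg_id _ (i := 0)).
  by rewrite add0r addr0.
have p2 z : (diff (cone attach) 2 1 z).2.1 = x *: (z.1 : S 0).
  rewrite !cone_diffE /= !(transport_deg_id _ (i := 1)).
  by rewrite oppr0 add0r.
have p3 z : (diff (cone attach) 3 2 z).1 = 0.
  by rewrite !cone_diffE /= shift_sphere_diff oppr0.
have E n m l z : m = n + 1 -> l = n - 1 -> x *: z =
    diff (cone attach) m n (h n m z) + h l n (diff (cone attach) n l z).
  by move=> em el; rewrite -(hE n m l em el) /= subr0.
pose b0 : R := (h 0 1 e0).2.1.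
pose a1 : R := (h 1 2 e1).1.
have E0 : x = x * b0.
  have := E 0 1 (-1) e0 erefl erefl; rewrite d0 linear0 addr0.
  move=> /(congr1 (fun z => z.2.2)); rewrite p1.
  exact: (etrans (esym (mulr1 x))).
have E1 : x = x * a1 + x * b0.
  have := E 1 2 0 e1 erefl erefl; rewrite d1 linearZ.
  move=> /(congr1 (fun z => z.2.1)) /(etrans (esym (mulr1 x))) e.
  apply: (etrans e).
  exact: (congr2 (@GRing.add R) (p2 (h 1 2 e1)) (erefl (x * b0))).
have E2 : x = x * a1.
  have := E 2 3 1 e2 erefl erefl; rewrite d2 linearZ.
  move=> /(congr1 fst) /(etrans (esym (mulr1 x))) e; apply: (etrans e).
  exact: (etrans (congr2 (@GRing.add R) (p3 (h 2 3 e2)) (erefl (x * a1)))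
            (add0r _)).
move: E1; rewrite -E2 -E0 => /eqP.
by rewrite -subr_eq0 opprD addrA subrr sub0r oppr_eq0 => /eqP.
Qed.

End SquareZero.

Lemma kproj_cone_scale (x : R) : kproj (cone (chscale x S)).
Proof. by apply: kproj_cone; apply: kproj_sphere. Qed.

Lemma thick_cone_scale (x : R) : thick_closure S (cone (chscale x S)).
Proof. by apply: thick_closure_cone; apply: thick_closure_self. Qed.

(** How the hypothesis is applied: vanishing on homology forces an actual
    null-homotopy. *)
Lemma generating_hypothesis_null (X Y : complex R) (f : chmap X Y) :
    generating_hypothesis R -> kproj X -> thick_closure S X ->
    thick_closure S Y ->
    (forall n (x : X n), is_cycle x -> is_boundary (f n x)) ->
  homotopic f (chzero X Y).
Proof.
move=> gh kX tX tY bf; apply: kproj_faithful kX _.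
exact: gh tX tY (pi_zero_boundary bf).
Qed.

Lemma generating_hypothesis_reduced :
  generating_hypothesis R -> forall x : R, x * x = 0 -> x = 0.
Proof.
move=> gh x xx; apply: (@cone_attach_null x xx).
have tC : thick_closure S (cone (attach xx)).
  apply: thick_closure_cone; last exact: thick_cone_scale.
  by apply: thick_closure_suspension; apply: thick_closure_self.
apply: (generating_hypothesis_null gh _ tC tC).
  by apply: kproj_cone; [apply: kproj_shift_sphere | apply: kproj_cone_scale].
exact: cone_attach_homology.
Qed.

(** The test map is the projection of cone (x^2) onto its top cell Sigma S,
    followed by x; a null-homotopy sends the bottom generator e0 to some y with
    x = x^2 y. *)
Lemma generating_hypothesis_von_neumann_regular :
  generating_hypothesis R -> von_neumann_regular R.
Proof.
move=> gh x; have red := generating_hypothesis_reduced gh.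
have red2 (r : R) : x * x * r = 0 -> x * r = 0.
  by move=> xxr; apply: red; rewrite mulrACA mulrA xxr mul0r.
pose f := chcomp (chscale x (shift 1 S)) (cone_out (chscale (x * x) S)).
have /homotopicP[h hE] : homotopic f (chzero _ _).
  apply: (generating_hypothesis_null gh).
  - exact: kproj_cone_scale.
  - exact: thick_cone_scale.
  - by apply: thick_closure_suspension; apply: thick_closure_self.
  move=> n [a b] /cone_cycleP[_] /= /esym/eqP; rewrite oppr_eq0 => /eqP xxa.
  exists 0; rewrite linear0 /cone_out_fun /=.
  move: a xxa {b}; rewrite /= /sphere_obj; case: eqP => [_ a /red2 //|_ a _].
  by apply/rowP => -[].
pose e0 : cone (chscale (x * x) S) 0 := (0, (1 : R^o)).
pose e1 : cone (chscale (x * x) S) 1 := ((1 : R^o), 0).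
have d1 : diff (cone (chscale (x * x) S)) 1 0 e1 = (x * x) *: e0.
  have -> : (x * x) *: e0 = ((x * x) *: 0, (x * x : R^o)) :> cone _ 0.
    by congr (_, _); apply: mulr1.
  rewrite !cone_diffE /= (transport_deg_id _ (i := 0)) oppr0 scaler0.
  by congr (_, _); rewrite add0r; apply: mulr1.
exists (h 0 1 e0 : R).
have := hE 1 2 0 erefl erefl e1; rewrite d1 linearZ shift_sphere_diff add0r.
move=> /(etrans (esym (etrans (subr0 (x * 1)) (mulr1 x)))) e.
by rewrite mulrAC; apply: esym e.
Qed.

End Reduced.

Theorem corollary1p3 (R : comPzRingType) :
  generating_hypothesis R <-> von_neumann_regular R.
Proof.
split; first exact: generating_hypothesis_von_neumann_regular.
exact: von_neumann_regular_generating_hypothesis.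
Qed.
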